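(* Let $\pi$ be a permutation of $[n]$ and let $\bm{x},\bm{x'}$ be two optimal displacement vectors of $\pi$. Then $$\mathrm{opt}_{\mathit{DV}}(\bm{x},\bm{x'})=\frac{\Delta(\bm{x},\bm{x'})}{2},\qquad\text{where } \Delta(\bm{x},\bm{x'})=\sum_{i\in[n]}(1-\delta_{x_i,x'_i})$$ is the number of indices $i$ with $x_i\ne x'_i$. Moreover, a reconfiguration sequence under max-min contractions of length $\mathrm{opt}_{\mathit{DV}}(\bm{x},\bm{x'})$ can be computed in $O(n+\mathrm{opt}_{\mathit{DV}}(\bm{x},\bm{x'}))$ time.
   Context: Let $[n]=\{1,\dots,n\}$ and $\pi=(\pi_1,\dots,\pi_n)$ a permutation of $[n]$. A cyclic ladder lottery of $\pi$ consists of $n$ vertical lines $1,\dots,n$ and finitely many horizontal bars at distinct heights. Each bar connects lines $k,k+1$ ($1\le k\le n-1$) or lines $n,1$. Start with element $i$ on top of line $i$ and sweep downward; each bar swaps the two elements on its lines. At the bottom, line $j$ must carry $\pi_j$. Such a lottery is optimal if it has the minimum number of bars among all cyclic ladder lotteries of $\pi$. The displacement vector $\mathit{DV}(L)=(x_1,\dots,x_n)\in\mathbb{Z}^n$ is defined by letting $x_i$ be the number of bars at which element $i$ moves one line right (line $k\to k+1$, or $n\to 1$) minus the number of bars at which it moves one line left. In general, a displacement vector of $\pi$ is an $\bm{x}\in\mathbb{Z}^n$ with $\sum_i x_i=0$ and $\pi_{(i+x_i)\bmod n}=i$ for all $i$. An optimal displacement vector of $\pi$ is $\mathit{DV}(L)$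 for some optimal cyclic ladder lottery $L$ of $\pi$. For an optimal displacement vector $\bm{x}$, let $\max(\bm{x}),\min(\bm{x})$ be its largest and smallest entries. If $x_i=\max(\bm{x})$, $x_j=\min(\bm{x})$ and $x_i-x_j=n$, the max-min contraction $T_{ij}(\bm{x})$ is the vector obtained from $\bm{x}$ by replacing $x_i$ with $x_i-n$ and $x_j$ with $x_j+n$, all other entries unchanged. $\mathrm{opt}_{\mathit{DV}}(\bm{x},\bm{x'})$ is the minimum length of a sequence of max-min contractions transforming $\bm{x}$ into $\bm{x'}$. $\delta$ is the Kronecker delta. *)

(* Defs.v *)
From mathcomp Require Import all_boot all_order all_fingroup all_algebra.

Set Implicit Arguments.
Unset Strict Implicit.
Unset Printing Implicit Defensive.

Import GRing.Theory Num.Theory.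
Local Open Scope ring_scope.

(* Lines and elements 1, ..., n are represented by 0, ..., n-1 : 'I_n, and a
   permutation pi = (pi_1, ..., pi_n) by the function sending a position j to
   the entry pi_j. *)

Section Lotteries.
Variable n : nat.

(* The bars from top to bottom. The bar k joins the line k to its cyclic
   successor [ordS k] on its right, so k = n-1 is the bar from the last line to
   the first one. For n = 2 the bars 0 and 1 join the same two lines but move
   the elements in opposite directions. *)
Definition lottery := seq 'I_n.

(* An arrangement [a] records that line j carries the element [a j]. Products in
   'S_n act on the left factor first: [swap a k] is [a] precomposed with the
   transposition of the lines of the bar k. *)
Definition swap (a : 'S_n) (k : 'I_n) : 'S_n := (tperm k (ordS k) * a)%g.

Definition bottom (L : lottery) : 'S_n := foldl swap 1%g L.

Definition is_lottery_of (pi : 'S_n) (L : lottery) : Prop :=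
  forall j, bottom L j = pi j.

Definition optimal_lottery (pi : 'S_n) (L : lottery) : Prop :=
  is_lottery_of pi L /\
  forall L', is_lottery_of pi L' -> (size L <= size L')%N.

Fixpoint displacement_from (a : 'S_n) (L : lottery) (i : 'I_n) : int :=
  if L is k :: L' then
    (a k == i)%:Z - (a (ordS k) == i)%:Z + displacement_from (swap a k) L' i
  else 0.

Definition DV (L : lottery) : {ffun 'I_n -> int} :=
  [ffun i => displacement_from 1%g L i].

Definition optimal_DV (pi : 'S_n) (x : {ffun 'I_n -> int}) : Prop :=
  exists2 L, optimal_lottery pi L & DV L = x.

Definition is_max (x : {ffun 'I_n -> int}) (i : 'I_n) : Prop :=
  forall k, x k <= x i.

Definition is_min (x : {ffun 'I_n -> int}) (j : 'I_n) : Prop :=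
  forall k, x j <= x k.

Definition contractible (x : {ffun 'I_n -> int}) (i j : 'I_n) : Prop :=
  [/\ is_max x i, is_min x j & x i - x j = n%:Z].

Definition contract (x : {ffun 'I_n -> int}) (i j : 'I_n) :
    {ffun 'I_n -> int} :=
  [ffun k => if k == i then x k - n%:Z
             else if k == j then x k + n%:Z else x k].

(* A sequence of contractions is given by the pairs (i, j) of the successive
   T_ij, each of which must be applied to an optimal displacement vector. *)
Fixpoint reconfigures (pi : 'S_n) (x : {ffun 'I_n -> int})
    (s : seq ('I_n * 'I_n)) (x' : {ffun 'I_n -> int}) : Prop :=
  if s is (i, j) :: s' then
    [/\ optimal_DV pi x, contractible x i j
      & reconfigures pi (contract x i j) s' x']
  else x = x'.

(* opt_DV(x, x') = m; a relation because a minimum of lengths only exists once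
   x' is known to be reachable from x. *)
Definition is_opt_DV (pi : 'S_n) (x x' : {ffun 'I_n -> int}) (m : nat) : Prop :=
  (exists2 s, reconfigures pi x s x' & size s = m) /\
  forall s, reconfigures pi x s x' -> (m <= size s)%N.

Definition Delta (x x' : {ffun 'I_n -> int}) : nat :=
  (\sum_(i < n) (1 - (x i == x' i)))%N.

End Lotteries.

(* The unit-cost random access machine of Cook and Reckhow (1973): registers
   X_0, X_1, ... holding integers, initially 0, a read-only input tape and a
   write-only output tape. *)
Inductive instr :=
| SetConst of nat & int
| AddReg of nat & nat & nat
| SubReg of nat & nat & nat
| LoadFrom of nat & nat
| StoreAt of nat & nat
| JumpPos of nat & nat
| ReadIn of nat
| WriteOut of nat.

Definition program := seq instr.

Record config := Config {
  pc : nat;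
  reg : nat -> int;
  input : seq int;
  output : seq int
}.

Definition assign (X : nat -> int) (a : nat) (v : int) : nat -> int :=
  fun b => if b == a then v else X b.

(* A configuration whose program counter is past the end of the program is
   halted. An indirect access to a negative address and a read at the end of the
   input leave the configuration unchanged, so that the machine then never
   halts. *)
Definition step (P : program) (c : config) : config :=
  let: Config p X inp out := c in
  let next X' := Config p.+1 X' inp out in
  match onth P p with
  | None => c
  | Some (SetConst i v) => next (assign X i v)
  | Some (AddReg i j k) => next (assign X i (X j + X k))
  | Some (SubReg i j k) => next (assign X i (X j - X k))
  | Some (LoadFrom i j) =>
      if X j is Posz a then next (assign X i (X a)) else c
  | Some (StoreAt i j) =>
      if X i is Posz a then next (assign X a (X j)) else c
  | Some (JumpPos l j) => if 0 < X j then Config l X inp out else next X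
  | Some (ReadIn i) =>
      if inp is v :: inp' then Config p.+1 (assign X i v) inp' out else c
  | Some (WriteOut i) => Config p.+1 X inp (rcons out (X i))
  end.

Definition outputs_within (P : program) (inp : seq int) (t : nat)
    (out : seq int) : Prop :=
  let c := iter t (step P) (Config 0 (fun=> 0) inp [::]) in
  (size P <= pc c)%N /\ output c = out.

(* The input tape holds n, pi_1, ..., pi_n, x_1, ..., x_n, x'_1, ..., x'_n, and
   a sequence of contractions is output as i_1, j_1, i_2, j_2, ...; elements are
   numbered from 1 on the tapes. *)
Definition encode_input n (pi : 'S_n) (x x' : {ffun 'I_n -> int}) : seq int :=
  n%:Z :: [seq (pi j).+1%:Z | j <- enum 'I_n]
    ++ [seq x i | i <- enum 'I_n] ++ [seq x' i | i <- enum 'I_n].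

Definition encode_contractions n (s : seq ('I_n * 'I_n)) : seq int :=
  flatten [seq [:: ij.1.+1%:Z; ij.2.+1%:Z] | ij : 'I_n * 'I_n <- s].

(* Main.v *)
(** For a displacement vector [x] put [f a = a + x a] and let the crossing
    number of [a] and [b] be [floor ((f a - f b) / n) - floor ((a - b) / n)]. A
    bar changes the crossing number of the two elements it swaps by one and no
    other, so a lottery has at least as many bars as the sum of the absolute
    crossing numbers over pairs; conversely, undoing a bar below which the
    smaller displacement stands on the left lowers this sum, so the bound is
    attained for every [x], and the optimal vectors are those minimizing the
    sum. In an optimal lottery no pair is swapped twice, so crossing numbers are
    in {-1, 0, 1} and absolute values can be replaced by squares; this gives
    [S (T_ij x) <= S x + 4 (n - (x_i - x_j))] for the sum [S] over ordered
    pairs. Hence optimal vectors satisfy [max x - min x <= n], and contractions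
    with [x_i - x_j = n] preserve optimality. If [x'] is also optimal,
    [x_i > x'_i] and [x_j < x'_j], then adding [x_i - x_j <= n] and
    [x'_j - x'_i <= n] forces [x_i - x_j = x_i - x'_i = x'_j - x_j = n]: the
    decreasing and the increasing indices may be paired arbitrarily and
    contracted in any order. *)
Require Import Defs.
From mathcomp Require Import all_boot all_order all_fingroup all_algebra.
From mathcomp Require Import zify ring.

Set Implicit Arguments.
Unset Strict Implicit.
Unset Printing Implicit Defensive.

Import Order.TTheory GRing.Theory Num.Theory.
Local Open Scope ring_scope.

(** * Floor division of integers *)

Lemma divz_unique (n d q : int) : q * n <= d < q * n + n -> (d %/ n)%Z = q.
Proof.
move=> /andP[le_d lt_d]; have n_gt0 : 0 < n by lia.
have -> : d = q * n + (d - q * n) by lia.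
by rewrite divzMDl ?gt_eqF // divz_small ?addr0 //; lia.
Qed.

Lemma divz_bounds (n d : int) :
  0 < n -> (d %/ n)%Z * n <= d < (d %/ n)%Z * n + n.
Proof.
move=> n_gt0; rewrite lez_floor ?gt_eqF //=.
by have := ltz_ceil d n_gt0; rewrite mulrDl mul1r.
Qed.

Lemma divz_succ (n d : int) :
  0 < n -> ((d + 1) %/ n)%Z = (d %/ n)%Z + (n %| d + 1)%Z%:Z.
Proof.
move=> n_gt0; have := divz_bounds d n_gt0; set q := (d %/ n)%Z => bd.
apply: divz_unique; case: dvdzP => [[r dr]|ndvd] /=.
  have r_eq : r = q + 1 by nia.
  by nia.
suff : d + 1 != q * n + n by lia.
by apply/eqP=> e; apply: ndvd; exists (q + 1); rewrite e; ring.
Qed.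

Lemma divzN (n d : int) :
  0 < n -> ~~ (n %| d)%Z -> ((- d) %/ n)%Z = - (d %/ n)%Z - 1.
Proof.
move=> n_gt0 ndvd; have := divz_bounds d n_gt0; set q := (d %/ n)%Z => bd.
apply: divz_unique; suff : d != q * n by lia.
by apply: contraNneq ndvd => ->; apply: dvdz_mull.
Qed.

(** * Displacement vectors, crossing numbers and the number of bars *)

Section Displacements.
Variable n : nat.
Implicit Types (x y : {ffun 'I_n -> int}) (pi : 'S_n) (a b i j k : 'I_n).
Implicit Types L : lottery n.

Let n_gt0 k : 0 < n%:Z.
Proof. by case: k => m; case: n. Qed.

Definition target x a : int := a%:Z + x a.

(** The congruence is indexed by the line [j] instead of the element: the element [pi j] must end on
    the line [j]. *)
Definition displaces pi x : Prop :=
  (forall j, (n %| target x (pi j) - j%:Z)%Z) /\ \sum_i x i = 0.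

(** The effect on [x] of one more bar [k] below the arrangement [pi]. *)
Definition bump pi x k : {ffun 'I_n -> int} :=
  [ffun i => x i + (pi k == i)%:Z - (pi (ordS k) == i)%:Z].

Definition crossings x a b : int :=
  ((target x a - target x b) %/ n)%Z - ((a%:Z - b%:Z) %/ n)%Z.

Lemma dvd_ord_eq i j : (n %| i%:Z - j%:Z)%Z = (i == j).
Proof.
apply/idP/eqP=> [/dvdzP[q e]|->]; last by rewrite subrr dvdz0.
have := ltn_ord i; have := ltn_ord j => lt_j lt_i.
have q0 : q = 0 by nia.
by apply: val_inj => /=; move: e; rewrite q0 mul0r; lia.
Qed.

Lemma dvd_ordS_eq i j : (n %| i%:Z - j%:Z + 1)%Z = (j == ordS i).
Proof.
rewrite -dvd_ord_eq /=.
have -> : j%:Z - ((i.+1 %% n)%N)%:Z =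
  ((i.+1 %/ n)%N)%:Z * n%:Z - (i%:Z - j%:Z + 1).
  by have := divn_eq i.+1 n; lia.
by rewrite rpredBl ?dvdz_mull.
Qed.

(** A target is congruent modulo [n] to the line that carries the element, so congruences between
    targets become congruences between lines. *)
Lemma dvd_target pi x j j' (c : int) : displaces pi x ->
  (n %| target x (pi j) - target x (pi j') + c)%Z =
  (n %| j%:Z - j'%:Z + c)%Z.
Proof.
case=> dvd _.
have -> : target x (pi j) - target x (pi j') + c =
  (target x (pi j) - j%:Z) - (target x (pi j') - j'%:Z) + (j%:Z - j'%:Z + c).
  by ring.
by rewrite rpredDl // rpredB.
Qed.

Lemma target_bump pi x k a :
  target (bump pi x k) a =
  target x a + (pi k == a)%:Z - (pi (ordS k) == a)%:Z.
Proof. by rewrite /target ffunE; ring. Qed.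

Lemma displaces_bump pi x k :
  displaces pi x -> displaces (swap pi k) (bump pi x k).
Proof.
case=> dvd sum0; split=> [j|].
  have dvdS : (n %| k%:Z - (ordS k)%:Z + 1)%Z by rewrite dvd_ordS_eq.
  rewrite target_bump permM !(inj_eq perm_inj).
  case: tpermP => [->|->|/eqP nk /eqP nSk].
  - have [kS|kS] := eqVneq k (ordS k); first by rewrite -kS eqxx addrK.
    rewrite eqxx.
    have := dvd (ordS k); rewrite -(rpredBr _ dvdS) => {}dvd.
    by apply: etrans dvd; congr (_ %| _)%Z; rewrite /=; ring.
  - rewrite eqxx eq_sym; have [kS|kS] := eqVneq k (ordS k).
      by rewrite -kS addrK.
    have := dvd k; rewrite -(rpredDr _ dvdS) => {}dvd.
    by apply: etrans dvd; congr (_ %| _)%Z; rewrite /=; ring.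
  - by rewrite ![_ == j]eq_sym (negPf nk) (negPf nSk) addr0 subr0.
rewrite (eq_bigr (fun i => x i + ((pi k == i)%:Z - (pi (ordS k) == i)%:Z))).
  rewrite big_split /= sum0 add0r sumrB.
  have sum_eq b : \sum_i (b == i)%:Z = 1.
    by rewrite (bigD1 b) //= eqxx big1 // => i; rewrite eq_sym => /negPf->.
  by rewrite !sum_eq subrr.
by move=> i _; rewrite ffunE addrA.
Qed.

(** The floor changes only when the difference of targets passes a multiple of [n], and by
    [dvd_target] a unit step does so only for elements on cyclically adjacent lines. *)
Lemma crossings_bump pi x k a b : displaces pi x ->
  crossings (bump pi x k) a b = crossings x a b
    + ((pi k == a) && (pi (ordS k) == b))%:Z
    - ((pi (ordS k) == a) && (pi k == b))%:Z.
Proof.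
move=> dis; rewrite -[a](permKV pi) -[b](permKV pi).
move: (pi^-1 a)%g (pi^-1 b)%g => {a b} i j.
rewrite /crossings !target_bump !(inj_eq perm_inj).
have subACA (u v a b c e : int) :
  u + a - b - (v + c - e) = (u - v) + ((a - b) - (c - e)) by ring.
rewrite subACA; set d : int := target x (pi i) - target x (pi j).
set c0 := (((pi i)%:Z - (pi j)%:Z) %/ n)%Z.
(* With a single line the bar joins it to itself, and both sides are unchanged; below, [n] is not
   1. *)
have [<-|nSk] := eqVneq k (ordS k).
  by rewrite !subrr addr0 andbC addrK.
have dvd_d c := dvd_target i j c dis; rewrite -/d in dvd_d.
have Sc e : ((d + e + 1) %/ n)%Z =
    ((d + e) %/ n)%Z + (n %| i%:Z - j%:Z + (e + 1))%Z%:Z.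
  by rewrite divz_succ ?(n_gt0 k) // -(addrA d e) dvd_d.
have up1 : ((d + 1) %/ n)%Z = (d %/ n)%Z + (j == ordS i)%:Z.
  by have := Sc 0; rewrite addr0 add0r dvd_ordS_eq.
have down1 : ((d - 1) %/ n)%Z = (d %/ n)%Z - (i == j)%:Z.
  have := Sc (-1); rewrite subrK addNr addr0 dvd_ord_eq => ->.
  by rewrite addrK.
have n_ndvd1 : ~~ (n %| 1)%Z.
  apply: contra nSk => /(dvdz_mull (k%:Z - (ordS k)%:Z)).
  by rewrite mulr1 dvd_ord_eq.
(* The swapped elements change their difference by 2; of the two unit steps only one meets a
   multiple of [n], as [n] does not divide 1. *)
have up2 : j = ordS i -> ((d + (1 + 1)) %/ n)%Z = (d %/ n)%Z + 1.
  move=> jSi; rewrite addrA Sc up1 jSi eqxx addrA.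
  by rewrite rpredDl ?dvd_ordS_eq // (negPf n_ndvd1) addr0.
have down2 : i = ordS j -> ((d + (- 1 - 1)) %/ n)%Z = (d %/ n)%Z - 1.
  move=> iSj; have := Sc (- 1 - 1).
  rewrite (addrA d) subrK down1 iSj subrK.
  have -> : (ordS j)%:Z - j%:Z - 1 = - (j%:Z - (ordS j)%:Z + 1) by ring.
  rewrite rpredN dvd_ordS_eq eqxx.
  have -> : (ordS j == j) = false.
    apply: contraNF n_ndvd1 => /eqP Sj.
    by have := dvd_ordS_eq j j; rewrite subrr add0r Sj eqxx => ->.
  by rewrite subr0 => ->; rewrite addrK.
have [ki|nki] := eqVneq k i.
  rewrite -ki in up1 up2 down1 down2 *.
  rewrite [ordS k == k]eq_sym (negPf nSk) /=.
  have [kj|nkj] := eqVneq k j.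
    by rewrite -kj [ordS k == k]eq_sym (negPf nSk) subrr addr0 /=; ring.
  have [Sj|nSj] := eqVneq (ordS k) j; last first.
    by rewrite !subr0 up1 eq_sym (negPf nSj) /=; ring.
  by rewrite sub0r subr0 opprK up2 //=; ring.
have [Ski|nSki] := eqVneq (ordS k) i.
  rewrite -Ski in up1 up2 down1 down2 *.
  have [kj|nkj] := eqVneq k j.
    rewrite -kj [ordS k == k]eq_sym (negPf nSk) /=.
    by rewrite subr0 sub0r down2 ?kj //=; ring.
  have [Skj|nSkj] := eqVneq (ordS k) j; first by rewrite subrr addr0 /=; ring.
  by rewrite sub0r !subr0 down1 (negPf nSkj) /=; ring.
have [kj|nkj] := eqVneq k j.
  rewrite -kj [ordS k == k]eq_sym (negPf nSk) /= !subr0 sub0r down1 -kj.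
  by rewrite eq_sym (negPf nki) /=; ring.
have [Skj|nSkj] := eqVneq (ordS k) j; last by rewrite !subrr addr0 /=; ring.
by rewrite !sub0r !opprK up1 -Skj (inj_eq (@ordS_inj n)) (negPf nki) /=; ring.
Qed.

(** For distinct elements neither difference is divisible by [n], so negation costs both floors the
    same [- 1], which cancels. *)
Lemma crossingsC pi x a b : displaces pi x ->
  crossings x b a = - crossings x a b.
Proof.
move=> dis; have [->|neq] := eqVneq a b.
  by rewrite /crossings !subrr.
have n0 := n_gt0 a; rewrite /crossings -(opprB (target x a)) -(opprB a%:Z).
rewrite !divzN ?dvd_ord_eq //; first by ring.
rewrite -[a](permKV pi) -[b](permKV pi) -[_ - _]addr0 (dvd_target _ _ _ dis).
by rewrite addr0 dvd_ord_eq (inj_eq perm_inj).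
Qed.

(** The difference [d] of targets is -1 modulo [n], so its floor is [(d + 1) / n - 1]; the
    inequality between displacements bounds [d + 1] by the difference of the elements. *)
Lemma crossings_lt0 pi x k : displaces pi x -> x (pi k) < x (pi (ordS k)) ->
  crossings x (pi k) (pi (ordS k)) < 0.
Proof.
move=> dis lt_x; rewrite subr_lt0.
have /dvdzP[q eq_q] :
    (n %| target x (pi k) - target x (pi (ordS k)) + 1)%Z.
  by rewrite (dvd_target _ _ _ dis) dvd_ordS_eq.
have n0 := n_gt0 k; set d := target x _ - _ in eq_q *.
have -> : (d %/ n)%Z = q - 1.
  by apply: divz_unique; rewrite mulrBl mul1r -eq_q; lia.
rewrite ltrBlDr ltzD1 lez_divRL // -eq_q /d /target; lia.
Qed.

(** The sum runs over ordered pairs, so one bar accounts for 2. *)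
Definition total_crossings x : int := \sum_a \sum_b `|crossings x a b|.

Lemma total_crossings_ge0 x : 0 <= total_crossings x.
Proof. by apply: sumr_ge0 => a _; apply: sumr_ge0. Qed.

Lemma sum_delta a b : \sum_i \sum_j ((a == i) && (b == j))%:Z = 1.
Proof.
rewrite (bigD1 a) //= (bigD1 b) //= !eqxx !big1 //.
  by move=> i; rewrite eq_sym => /negPf->; rewrite big1.
by move=> i; rewrite eq_sym => /negPf->.
Qed.

Lemma total_crossings_bump_le pi x k : displaces pi x ->
  total_crossings (bump pi x k) <= total_crossings x + 2.
Proof.
move=> dis; rewrite -[2]/(1 + 1) -{1}(sum_delta (pi k) (pi (ordS k))).
rewrite -(sum_delta (pi (ordS k)) (pi k)) -!big_split /=.
apply: ler_sum => a _; rewrite -!big_split /=; apply: ler_sum => b _.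
rewrite (crossings_bump _ _ _ dis); move: (crossings x a b) => c.
by case: andP => _; case: andP => _; lia.
Qed.

Lemma total_crossings_bump pi x k : displaces pi x ->
  x (pi k) < x (pi (ordS k)) ->
  total_crossings (bump pi x k) = total_crossings x - 2.
Proof.
move=> dis lt_x; have cr_lt0 := crossings_lt0 dis lt_x.
have neq : pi k != pi (ordS k) by apply: contraTneq lt_x => ->; rewrite ltxx.
rewrite -[2]/(1 + 1) -{1}(sum_delta (pi k) (pi (ordS k))).
rewrite -(sum_delta (pi (ordS k)) (pi k)) -big_split -sumrB /=.
apply: eq_bigr => a _; rewrite -big_split -sumrB /=; apply: eq_bigr => b _.
rewrite (crossings_bump _ _ _ dis).
have : (pi k == a) && (pi (ordS k) == b) -> crossings x a b < 0.
  by case/andP=> /eqP<- /eqP<-.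
have : (pi (ordS k) == a) && (pi k == b) -> 0 < crossings x a b.
  by case/andP=> /eqP<- /eqP<-; rewrite (crossingsC _ _ dis) oppr_gt0.
have : ~~ [&& pi k == a & pi (ordS k) == a].
  by apply: contra neq => /andP[/eqP-> /eqP->].
move: (crossings x a b) => c.
by case: (pi k == a); case: (pi (ordS k) == a); case: (pi k == b);
  case: (pi (ordS k) == b) => //=; lia.
Qed.

Lemma iter_ordS t k : val (iter t (@ordS n) k) = ((k + t) %% n)%N.
Proof.
elim: t => [|t IHt] /=; first by rewrite addn0 modn_small.
by rewrite IHt -addn1 modnDml addn1 addnS.
Qed.

Lemma ordS_nonincreasing_const (g : 'I_n -> int) :
  (forall k, g (ordS k) <= g k) -> forall k j, g k = g j.
Proof.
move=> le_g; have le_iter t k : g (iter t (@ordS n) k) <= g k.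
  by elim: t => //= t; apply: le_trans.
have reach k j : g j <= g k.
  (* The summand [n] keeps the truncated subtraction exact and vanishes modulo [n]. *)
  suff -> : j = iter (j + n - k) (@ordS n) k by apply: le_iter.
  apply: val_inj; rewrite iter_ordS subnKC ?modnDr ?modn_small //.
  by apply: (leq_trans (ltnW (ltn_ord k))); apply: leq_addl.
by move=> k j; apply: le_anti; rewrite !reach.
Qed.

(** Without an ascent the displacements weakly decrease all around the cycle, hence are constant,
    hence zero by the sum; the congruences then fix every line. *)
Lemma displaces_ascent pi x : displaces pi x ->
  (exists k, x (pi k) < x (pi (ordS k))) \/ (pi = 1%g /\ x = [ffun=> 0]).
Proof.
case=> dvd sum0.
have [/existsP|noasc] := boolP [exists k, x (pi k) < x (pi (ordS k))].
  by left.
right; have const k j : x (pi k) = x (pi j).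
  apply: (ordS_nonincreasing_const (g := fun k => x (pi k))) => {}k.
  by move/existsPn: noasc => /(_ k); rewrite -leNgt.
have x0 a : x a = 0.
  have {}const b : x b = x a.
    by rewrite -[a](permKV pi) -[b](permKV pi); apply: const.
  move: sum0; rewrite (eq_bigr (fun=> x a)) // sumr_const card_ord => /eqP.
  by have := n_gt0 a; rewrite mulrn_eq0 => n0 /orP[/eqP n_eq0|/eqP//]; lia.
split; last by apply/ffunP=> a; rewrite ffunE.
apply/permP=> j; rewrite perm1; apply/eqP.
by have := dvd j; rewrite /target x0 addr0 dvd_ord_eq.
Qed.

Lemma bump_swapK pi x k : bump (swap pi k) (bump pi x k) k = x.
Proof.
apply/ffunP=> i; rewrite !ffunE !permM tpermL tpermR; ring.
Qed.

Lemma swapK pi k : swap (swap pi k) k = pi.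
Proof. by rewrite /swap mulgA tperm2 mul1g. Qed.

Lemma bottom_rcons L k : bottom (rcons L k) = swap (bottom L) k.
Proof. by rewrite /bottom foldl_rcons. Qed.

Lemma DV_rcons L k : DV (rcons L k) = bump (bottom L) (DV L) k.
Proof.
apply/ffunP=> i; rewrite !ffunE /bottom.
by elim: L 1%g => [|k' L IHL] a /=; [ring | rewrite IHL; ring].
Qed.

Lemma displaces_DV L : displaces (bottom L) (DV L).
Proof.
elim/last_ind: L => [|L k IHL].
  split=> [j|]; first by rewrite perm1 /target ffunE /= addr0 subrr dvdz0.
  by apply: big1 => i _; rewrite ffunE.
by rewrite bottom_rcons DV_rcons; apply: displaces_bump.
Qed.

Lemma crossings_DV_nil a b : crossings (DV [::]) a b = 0.
Proof. by rewrite /crossings /target !ffunE /= !addr0 subrr. Qed.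

(** A bar moving [a] to the right raises one crossing number [crossings _ a b] by one, a move to the
    left lowers one. This brings the entries of [x] into the estimate for contractions. *)
Lemma sum_crossings_DV L a : \sum_b crossings (DV L) a b = DV L a.
Proof.
elim/last_ind: L => [|L k IHL].
  by rewrite big1 ?ffunE // => b _; apply: crossings_DV_nil.
rewrite DV_rcons [in RHS]ffunE -IHL.
under eq_bigr => b _ do rewrite (crossings_bump _ _ _ (displaces_DV L)).
rewrite sumrB big_split /=; congr (_ + _ - _).
  rewrite (bigD1 (bottom L (ordS k))) //= eqxx andbT big1 ?addr0 // => b.
  by rewrite eq_sym => /negPf->; rewrite andbF.
rewrite (bigD1 (bottom L k)) //= eqxx andbT big1 ?addr0 // => b.
by rewrite eq_sym => /negPf->; rewrite andbF.
Qed.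

Lemma total_crossings_DV L : total_crossings (DV L) <= 2 * (size L)%:Z.
Proof.
elim/last_ind: L => [|L k IHL].
  rewrite mulr0 le_eqVlt; apply/orP; left; apply/eqP.
  by apply: big1 => a _; apply: big1 => b _; rewrite crossings_DV_nil.
rewrite DV_rcons size_rcons.
by have := total_crossings_bump_le k (displaces_DV L); lia.
Qed.

(** Bars are stripped from below: at an ascent [k], [bump pi x k] is a displacement vector of
    [swap pi k] with total smaller by 2, and appending the bar [k] to a lottery realizing it
    restores [pi] and [x]. *)
Lemma lottery_of_displacement pi x : displaces pi x ->
  exists L, [/\ bottom L = pi, DV L = x & 2 * (size L)%:Z <= total_crossings x].
Proof.
have [m] := ubnP `|total_crossings x|%N.
elim: m pi x => // m IHm pi x lt_m dis.
have [[k lt_x]|[-> ->]] := displaces_ascent dis; last first.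
  exists [::]; split=> [//||].
  - by apply/ffunP=> i; rewrite !ffunE.
  - by rewrite mulr0 total_crossings_ge0.
have tc := total_crossings_bump dis lt_x.
have tc_ge0 := total_crossings_ge0 (bump pi x k).
have [||L [botL DVL sizeL]] := IHm (swap pi k) (bump pi x k).
- by lia.
- exact: displaces_bump.
exists (rcons L k); rewrite bottom_rcons DV_rcons botL DVL size_rcons.
by rewrite swapK bump_swapK; split=> //; lia.
Qed.
End Displacements.

(** * Optimal lotteries and the effect of a contraction *)

Section Optimality.
Variable n : nat.
Implicit Types (x y : {ffun 'I_n -> int}) (pi : 'S_n) (a b i j k : 'I_n).
Implicit Types L : lottery n.

Definition swaps (pi : 'S_n) k a b : bool :=
  (pi k == a) && (pi (ordS k) == b) || (pi (ordS k) == a) && (pi k == b).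

(** Transposing two lines before [pi] is transposing the elements they carry after [pi]. *)
Lemma swap_tperm pi k a b : swaps pi k a b -> swap pi k = (pi * tperm a b)%g.
Proof.
by case/orP=> /andP[/eqP<- /eqP<-]; rewrite /swap conjgC tpermJ // tpermC.
Qed.

Lemma crossings_rcons L k a b :
  ~~ swaps (bottom L) k a b ->
  crossings (DV (rcons L k)) a b = crossings (DV L) a b.
Proof.
rewrite /swaps negb_or => /andP[/negPf no /negPf no'].
by rewrite DV_rcons (crossings_bump _ _ _ (displaces_DV L)) no no' addr0 subr0.
Qed.

(** A nonzero crossing number requires a bar that swaps [a] and [b]; the lowest such bar is deleted,
    and the bars below it then see the two elements exchanged. *)
Lemma uncross L a b : crossings (DV L) a b != 0 ->
  exists2 L', bottom L' = (bottom L * tperm a b)%g & (size L' < size L)%N.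
Proof.
elim/last_ind: L => [|L k IHL]; first by rewrite crossings_DV_nil eqxx.
rewrite bottom_rcons size_rcons.
have [sw _|nsw] := boolP (swaps (bottom L) k a b).
  by exists L => //; rewrite (swap_tperm sw) -mulgA tperm2 mulg1.
rewrite crossings_rcons // => /IHL[L' botL' szL']; exists (rcons L' k).
  by rewrite bottom_rcons botL' /swap mulgA.
by rewrite size_rcons.
Qed.

(* A bar that swaps a and b can be removed at the price of exchanging a and b
   below it, so two such bars can be removed together. *)
Lemma uncross2 L a b : 1 < `|crossings (DV L) a b| ->
  exists2 L', bottom L' = bottom L & (size L' < size L)%N.
Proof.
elim/last_ind: L => [|L k IHL]; first by rewrite crossings_DV_nil normr0.
rewrite bottom_rcons size_rcons.
have [sw|nsw] := boolP (swaps (bottom L) k a b); last first.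
  rewrite crossings_rcons // => /IHL[L' botL' szL']; exists (rcons L' k).
    by rewrite bottom_rcons botL'.
  by rewrite size_rcons.
rewrite DV_rcons (crossings_bump _ _ _ (displaces_DV L)) => lt1.
(* The last bar contributes at most one, so the crossing number above it is still nonzero. *)
have /uncross[L' botL' szL'] : crossings (DV L) a b != 0.
  apply: contraTneq lt1 => ->.
  by rewrite add0r; do 2!case: (_ && _).
by exists L'; rewrite ?(swap_tperm sw) // ltnW.
Qed.

Lemma optimal_crossings pi L a b :
  optimal_lottery pi L -> `|crossings (DV L) a b| <= 1.
Proof.
case=> /permP botL minL; rewrite leNgt; apply/negP=> /uncross2[L' botL'].
by apply/negP; rewrite -leqNgt minL // => j; rewrite botL' botL.
Qed.

Lemma optimal_DV_displaces pi x : optimal_DV pi x -> displaces pi x.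
Proof.
by case=> L [/permP<- _] <-; apply: displaces_DV.
Qed.

(** Chains the lower bound on bars for an optimal lottery of [x] with a lottery of [y] that attains
    its bound. *)
Lemma optimal_DV_le pi x y : optimal_DV pi x -> displaces pi y ->
  total_crossings x <= total_crossings y.
Proof.
case=> L [_ minL] <- /lottery_of_displacement[L' [botL' _ szL']].
apply: le_trans (total_crossings_DV L) _; apply: le_trans szL'.
by rewrite ler_pM2l // lez_nat minL // => j; rewrite botL'.
Qed.

Lemma optimal_DV_min pi x y : optimal_DV pi x -> displaces pi y ->
  total_crossings y <= total_crossings x -> optimal_DV pi y.
Proof.
case=> L [_ minL] <- /lottery_of_displacement[L' [botL' DVL' szL']] le_yx.
exists L' => //; split=> [j|L'' /minL]; first by rewrite botL'.
apply: leq_trans; rewrite -lez_nat -(ler_pM2l (_ : 0 < 2)) //.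
by apply: le_trans szL' (le_trans le_yx (total_crossings_DV L)).
Qed.

(** For distinct [i] and [j], [contract x i j] is [x] plus [n] times this vector. *)
Definition transfer i j a : int := (a == j)%:Z - (a == i)%:Z.

Lemma sum_transfer (f : 'I_n -> int) i j :
  \sum_a f a * transfer i j a = f j - f i.
Proof.
have sum1 b : \sum_a f a * (a == b)%:Z = f b.
  rewrite (bigD1 b) //= eqxx mulr1 big1 ?addr0 // => a /negPf->.
  by rewrite mulr0.
under eq_bigr => a _ do rewrite mulrBr.
by rewrite sumrB !sum1.
Qed.

Lemma target_contract x i j a : i != j ->
  target (contract x i j) a = transfer i j a * n%:Z + target x a.
Proof.
move=> neq; rewrite /target ffunE /transfer.
have [->|_] := eqVneq a i; first by rewrite (negPf neq) /=; ring.
by case: eqP => _ /=; ring.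
Qed.

Lemma displaces_contract pi x i j : i != j ->
  displaces pi x -> displaces pi (contract x i j).
Proof.
move=> neq [dvd sum0]; split=> [k|].
  by rewrite target_contract // -addrA rpredDl ?dvdz_mull.
rewrite (eq_bigr (fun a => n%:Z * transfer i j a + x a)) => [|a _].
  by rewrite big_split /= sum0 sum_transfer subrr.
have := target_contract x a neq; rewrite /target.
by move/(canRL (addKr _)) ->; ring.
Qed.

Lemma crossings_contract x i j a b : i != j ->
  crossings (contract x i j) a b =
  crossings x a b + (transfer i j a - transfer i j b).
Proof.
move=> neq; rewrite /crossings !target_contract //.
have -> (t u t' u' : int) :
  t * n%:Z + u - (t' * n%:Z + u') = (t - t') * n%:Z + (u - u').
  by ring.
by rewrite divzMDl; [ring | have := ltn_ord a; lia].
Qed.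

Lemma total_crossings_contract pi L i j : optimal_lottery pi L -> i != j ->
  total_crossings (contract (DV L) i j) <=
  total_crossings (DV L) + 4 * (n%:Z - (DV L i - DV L j)).
Proof.
move=> optL neq; set x := DV L; set c := crossings x; set t := transfer i j.
have c_sq a b : `|c a b| = c a b ^+ 2.
  by have := optimal_crossings a b optL; rewrite -/x -/c; nia.
(* The expansion of [(c a b + t a - t b) ^+ 2], with [c a b ^+ 2] written as an absolute value and
   antisymmetry used so that both mixed terms sum to [x j - x i]. *)
pose square a b := `|c a b| + (2 * (c a b * t a) + 2 * (c b a * t b))
  + (t a ^+ 2 + t b ^+ 2 - 2 * (t a * t b)).
have le_square a b : `|crossings (contract x i j) a b| <= square a b.
  rewrite /square crossings_contract // c_sq -/t -/c.
  rewrite [c b a](crossingsC _ _ (displaces_DV L)) -/x -/c.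
  have le_sq (u : int) : `|u| <= u ^+ 2 by nia.
  by rewrite (le_trans (le_sq _)) // le_eqVlt; apply/orP; left; apply/eqP; ring.
have sum_c a : \sum_b c a b = x a by apply: sum_crossings_DV.
have sum_t : \sum_a t a = 0.
  by have := sum_transfer (fun=> 1) i j; under eq_bigr do rewrite mul1r.
have sum_t2 : \sum_a t a ^+ 2 = 2.
  under eq_bigr => a _ do rewrite expr2.
  by rewrite sum_transfer /t /transfer !eqxx [j == i]eq_sym (negPf neq).
have sum_ct : \sum_a \sum_b c a b * t a = x j - x i.
  under eq_bigr => a _ do rewrite -mulr_suml sum_c.
  exact: sum_transfer.
have sum_ct' : \sum_a \sum_b c b a * t b = x j - x i.
  by rewrite exchange_big.
have sum_tt : \sum_a \sum_b t a * t b = 0.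
  by apply: big1 => a _; rewrite -mulr_sumr sum_t mulr0.
have sum_tc : \sum_a \sum_(b < n) t a ^+ 2 = 2 * n%:Z.
  under eq_bigr => a _ do rewrite sumr_const card_ord -mulr_natr natz.
  by rewrite -mulr_suml sum_t2.
have sum_tc' : \sum_(a < n) \sum_b t b ^+ 2 = 2 * n%:Z by rewrite exchange_big.
apply: (@le_trans _ _ (\sum_a \sum_b square a b)).
  by apply: ler_sum => a _; apply: ler_sum => b _.
rewrite /square le_eqVlt; apply/orP; left; apply/eqP.
under eq_bigr => a _.
  rewrite big_split big_split sumrB /= !big_split /= -!(mulr_sumr _ _ _ 2).
  over.
rewrite big_split big_split sumrB /= !big_split /= -!(mulr_sumr _ _ _ 2).
rewrite sum_ct sum_ct' sum_tt sum_tc sum_tc' /total_crossings -/c; ring.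
Qed.

Lemma optimal_DV_range pi x i j : optimal_DV pi x -> x i - x j <= n%:Z.
Proof.
move=> optx; have disx := optimal_DV_displaces optx.
have [->|neq] := eqVneq i j; first by rewrite subrr.
have := optimal_DV_le optx (displaces_contract neq disx).
by case: optx => L optL <-; have := total_crossings_contract optL neq; lia.
Qed.

Lemma optimal_DV_contract pi x i j : optimal_DV pi x ->
  x i - x j = n%:Z -> optimal_DV pi (contract x i j).
Proof.
move=> optx eq_n; have disx := optimal_DV_displaces optx.
have neq : i != j.
  by apply: contra_eq_neq eq_n => ->; rewrite subrr; have := ltn_ord j; lia.
apply: optimal_DV_min (optx) (displaces_contract neq disx) _.
case: optx eq_n => L optL <- eq_n.
by have := total_crossings_contract optL neq; rewrite eq_n subrr mulr0 addr0.
Qed.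

End Optimality.

(** * The minimum length of a reconfiguration sequence *)

Section Reconfiguration.
Variable n : nat.
Implicit Types (x y : {ffun 'I_n -> int}) (pi : 'S_n) (a b i j k : 'I_n).

(** Listed in increasing order, as the program finds them; the rises from [x] to [y] are
    [drops y x]. *)
Definition drops x y : seq 'I_n := [seq a <- enum 'I_n | y a < x a].

Lemma displaces_dvd_sub pi x y a :
  displaces pi x -> displaces pi y -> (n %| x a - y a)%Z.
Proof.
move=> [dvdx _] [dvdy _]; rewrite -[a](permKV pi).
have := rpredB (dvdx (pi^-1 a)%g) (dvdy (pi^-1 a)%g).
by apply: etrans; congr (_ %| _)%Z; rewrite /target; ring.
Qed.

Lemma dvdz_gt0_ge (d : int) : (n %| d)%Z -> 0 < d -> n%:Z <= d.
Proof. case/dvdzP=> q -> qn_gt0; have : 0 < q by nia.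
by nia. Qed.

(** The drop and the rise are positive multiples of [n], while together they equal
    [(x i - x j) + (y j - y i)], which is at most [2 n]. *)
Lemma optimal_DV_drop_rise pi x y i j :
  optimal_DV pi x -> optimal_DV pi y -> y i < x i -> x j < y j ->
  [/\ x i - x j = n%:Z, x i - y i = n%:Z & y j - x j = n%:Z].
Proof.
move=> optx opty lt_i lt_j.
have [disx disy] := (optimal_DV_displaces optx, optimal_DV_displaces opty).
have ge_i := dvdz_gt0_ge (displaces_dvd_sub i disx disy).
have ge_j := dvdz_gt0_ge (displaces_dvd_sub j disy disx).
have := optimal_DV_range i j optx; have := optimal_DV_range j i opty.
rewrite !subr_gt0 in ge_i ge_j; have {}ge_i := ge_i lt_i.
have {}ge_j := ge_j lt_j; split; lia.
Qed.

Lemma exists_rise pi x y i : displaces pi x -> displaces pi y -> y i < x i ->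
  exists j, x j < y j.
Proof.
move=> [_ sumx] [_ sumy] lt_i; apply/existsP; apply: contraLR lt_i.
rewrite negb_exists => /forallP le_yx; rewrite -leNgt -subr_le0.
have ge0 a : 0 <= x a - y a by rewrite subr_ge0 leNgt.
have : \sum_a (x a - y a) = 0 by rewrite sumrB sumx sumy subrr.
rewrite (bigD1 i) //= => /eqP; rewrite addr_eq0 => /eqP->.
by rewrite oppr_le0 sumr_ge0.
Qed.

(** As both vectors sum to zero, each drop is accompanied by a rise and conversely, so every change
    is 0 or exactly [n] in size. *)
Lemma optimal_DV_diff pi x y a : optimal_DV pi x -> optimal_DV pi y ->
  x a - y a = n%:Z * ((y a < x a)%R%:Z - (x a < y a)%R%:Z).
Proof.
move=> optx opty.
have [disx disy] := (optimal_DV_displaces optx, optimal_DV_displaces opty).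
have [lt_xy|lt_yx|->] := ltrgtP (x a) (y a); last by rewrite !subrr mulr0.
  have [j lt_j] := exists_rise disy disx lt_xy.
  have [_ _] := optimal_DV_drop_rise optx opty lt_j lt_xy.
  by rewrite /= => <-; ring.
have [j lt_j] := exists_rise disx disy lt_yx.
have [_ -> _] := optimal_DV_drop_rise optx opty lt_yx lt_j.
by rewrite subr0 mulr1.
Qed.

Lemma size_drops x y : (size (drops x y))%:Z = \sum_a (y a < x a)%R%:Z.
Proof.
rewrite size_filter -sum1_count big_mkcond /= big_enum /= -natz natr_sum.
by apply: eq_bigr => a _; case: (_ < _).
Qed.

Lemma size_dropsC pi x y : optimal_DV pi x -> optimal_DV pi y ->
  size (drops x y) = size (drops y x).
Proof.
move=> optx opty.
have [_ sumx] := optimal_DV_displaces optx.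
have [_ sumy] := optimal_DV_displaces opty.
(* An index witnesses [0 < n], needed to cancel the factor [n]; for [n = 0] both lists are empty. *)
have [->//|[a _]] : drops x y = drops y x \/ exists a : 'I_n, true.
  case: (posnP n) => [n0|n_gt0]; last by right; exists (Ordinal n_gt0).
  by left; rewrite /drops; case: (enum 'I_n) => // a; have := ltn_ord a; lia.
have : \sum_a (x a - y a) = 0 by rewrite sumrB sumx sumy subrr.
under eq_bigr => b _ do rewrite (optimal_DV_diff _ optx opty).
rewrite -mulr_sumr sumrB -!size_drops.
by have := ltn_ord a; nia.
Qed.

Lemma Delta_drops x y :
  Delta x y = (size (drops x y) + size (drops y x))%N.
Proof.
apply/eqP; rewrite -eqz_nat PoszD !size_drops -big_split /= /Delta.
rewrite -[X in X == _]natz natr_sum.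
by apply/eqP/eq_bigr => a _; case: ltrgtP.
Qed.

Lemma Delta_contract x y i j :
  (Delta x y <= Delta (contract x i j) y + 2)%N.
Proof.
have sum1 k : (\sum_(a < n) (a == k) = 1)%N.
  by rewrite (bigD1 k) //= eqxx big1 // => a /negPf->.
rewrite -[2%N]/(1 + 1)%N -{1}(sum1 i) -(sum1 j) /Delta -!big_split /=.
apply: leq_sum => a _; rewrite ffunE.
by case: (a == i); case: (a == j) => /=; lia.
Qed.

Lemma Delta_le_reconfigures pi x y s :
  reconfigures pi x s y -> (Delta x y <= (size s).*2)%N.
Proof.
elim: s x => [|[i j] s IHs] x /=.
  by move=> ->; rewrite /Delta big1 // => a _; rewrite eqxx.
by case=> _ _ /IHs; have := Delta_contract x y i j; lia.
Qed.

(** Contracting the first pair makes both entries agree with [y] and changes no other, so the tails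
    of [D] and [I] list the remaining drops and rises of a vector that is again optimal. *)
Lemma reconfigures_zip pi x y D I : optimal_DV pi x -> optimal_DV pi y ->
  uniq D -> uniq I -> size D = size I ->
  D =i [pred a | y a < x a] -> I =i [pred a | x a < y a] ->
  reconfigures pi x (zip D I) y.
Proof.
move=> + opty; elim: D I x => [|i D IHD] [|j I] x //= optx.
  move=> _ _ _ memD memI; apply/ffunP=> a; apply: le_anti.
  by rewrite !leNgt -[_ < _](memD a) -[x a < _](memI a).
case/andP=> niD uD /andP[njI uI] [eqsz] memD memI.
have lt_i : y i < x i by have := memD i; rewrite !inE eqxx => <-.
have lt_j : x j < y j by have := memI j; rewrite !inE eqxx => <-.
have [eq_n eq_i eq_j] := optimal_DV_drop_rise optx opty lt_i lt_j.
split=> //.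
  (* The range of [x] is at most [n], so two entries at distance [n] are the extremes. *)
  split=> // k.
    by have := optimal_DV_range k j optx; lia.
  by have := optimal_DV_range i k optx; lia.
have contrE k : contract x i j k =
    if (k == i) || (k == j) then y k else x k.
  rewrite ffunE; have [->|_] := eqVneq k i; first by rewrite /=; lia.
  by have [->|_] := eqVneq k j; rewrite //=; lia.
apply: IHD => //; first exact: optimal_DV_contract.
- move=> k; rewrite inE contrE; have := memD k; rewrite !inE.
  have [->|_] := eqVneq k i; first by rewrite ltxx (negPf niD).
  by have [->|_] //= := eqVneq k j; rewrite ltxx => ->; lia.
- move=> k; rewrite inE contrE; have := memI k; rewrite !inE.
  have [->|_] := eqVneq k j; first by rewrite orbT ltxx (negPf njI).
  by have [->|_] //= := eqVneq k i; rewrite ltxx => ->; lia.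
Qed.

Lemma reconfigures_drops pi x y : optimal_DV pi x -> optimal_DV pi y ->
  reconfigures pi x (zip (drops x y) (drops y x)) y.
Proof.
move=> optx opty; apply: reconfigures_zip => //.
- by rewrite filter_uniq ?enum_uniq.
- by rewrite filter_uniq ?enum_uniq.
- exact: size_dropsC optx opty.
- by move=> a; rewrite mem_filter mem_enum andbT.
- by move=> a; rewrite mem_filter mem_enum andbT.
Qed.

Lemma is_opt_DV_drops pi x y : optimal_DV pi x -> optimal_DV pi y ->
  is_opt_DV pi x y (size (drops x y)).
Proof.
move=> optx opty; have eqsz := size_dropsC optx opty; split.
  exists (zip (drops x y) (drops y x)); first exact: reconfigures_drops.
  by rewrite size1_zip // eqsz.
move=> s /Delta_le_reconfigures; rewrite Delta_drops -eqsz addnn.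
by rewrite leq_double.
Qed.

Lemma is_opt_DV_inj pi x y m m' :
  is_opt_DV pi x y m -> is_opt_DV pi x y m' -> m = m'.
Proof.
move=> [[s rs <-] min_m] [[s' rs' <-] min_m'].
by apply/eqP; rewrite eqn_leq min_m ?min_m'.
Qed.

End Reconfiguration.

(** * Executions of the random access machine *)

Definition halts (P : program) (t : nat) (c : config) (out : seq int) : Prop :=
  exists2 k, (k <= t)%N &
    (size P <= pc (iter k (step P) c))%N /\ output (iter k (step P) c) = out.

Section Execution.
Variable P : program.
Implicit Types (X : nat -> int) (inp out o : seq int) (c : config).

Lemma halts_leq t t' c o : (t <= t')%N -> halts P t c o -> halts P t' c o.
Proof. by move=> le_t [k le_k]; exists k => //; apply: leq_trans le_t. Qed.

(** A halted configuration is a fixed point of [step], so surplus time is harmless. *)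
Lemma halts_outputs_within t inp o :
  halts P t (Config 0 (fun=> 0) inp [::]) o -> outputs_within P inp t o.
Proof.
case=> k le_k [hlt out_eq]; rewrite /outputs_within -(subnK le_k) iterD.
set c := iter k _ _ in hlt out_eq *.
suff -> : iter (t - k) (step P) c = c by [].
elim: (t - k)%N => //= j ->; case: c hlt {out_eq} => p X i u /= hlt.
by rewrite /step onth_default.
Qed.

Lemma halts_end t p X inp o : (size P <= p)%N -> halts P t (Config p X inp o) o.
Proof. by exists 0. Qed.

Lemma halts_step t c o : halts P t (step P c) o -> halts P t.+1 c o.
Proof. by case=> k le_k hlt; exists k.+1; rewrite ?iterSr. Qed.

Variables (t p : nat) (X : nat -> int) (inp out o : seq int).

Lemma halts_SetConst i v : onth P p = Some (SetConst i v) ->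
  halts P t (Config p.+1 (assign X i v) inp out) o ->
  halts P t.+1 (Config p X inp out) o.
Proof. by move=> eqP hlt; apply: halts_step; rewrite /step eqP. Qed.

Lemma halts_AddReg i j k : onth P p = Some (AddReg i j k) ->
  halts P t (Config p.+1 (assign X i (X j + X k)) inp out) o ->
  halts P t.+1 (Config p X inp out) o.
Proof. by move=> eqP hlt; apply: halts_step; rewrite /step eqP. Qed.

Lemma halts_SubReg i j k : onth P p = Some (SubReg i j k) ->
  halts P t (Config p.+1 (assign X i (X j - X k)) inp out) o ->
  halts P t.+1 (Config p X inp out) o.
Proof. by move=> eqP hlt; apply: halts_step; rewrite /step eqP. Qed.

Lemma halts_LoadFrom i j (a : nat) : onth P p = Some (LoadFrom i j) ->
  X j = a -> halts P t (Config p.+1 (assign X i (X a)) inp out) o ->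
  halts P t.+1 (Config p X inp out) o.
Proof. by move=> eqP Xj hlt; apply: halts_step; rewrite /step eqP Xj. Qed.

Lemma halts_StoreAt i j (a : nat) : onth P p = Some (StoreAt i j) ->
  X i = a -> halts P t (Config p.+1 (assign X a (X j)) inp out) o ->
  halts P t.+1 (Config p X inp out) o.
Proof. by move=> eqP Xi hlt; apply: halts_step; rewrite /step eqP Xi. Qed.

Lemma halts_JumpPos l j : onth P p = Some (JumpPos l j) ->
  halts P t (Config (if 0 < X j then l else p.+1) X inp out) o ->
  halts P t.+1 (Config p X inp out) o.
Proof.
by move=> eqP hlt; apply: halts_step; rewrite /step eqP; case: ifP hlt.
Qed.

Lemma halts_ReadIn i v : onth P p = Some (ReadIn i) ->
  halts P t (Config p.+1 (assign X i v) inp out) o ->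
  halts P t.+1 (Config p X (v :: inp) out) o.
Proof. by move=> eqP hlt; apply: halts_step; rewrite /step eqP. Qed.

Lemma halts_WriteOut i : onth P p = Some (WriteOut i) ->
  halts P t (Config p.+1 X inp (rcons out (X i))) o ->
  halts P t.+1 (Config p X inp out) o.
Proof. by move=> eqP hlt; apply: halts_step; rewrite /step eqP. Qed.

End Execution.

(** * The memory layout and the running time of the program *)

Definition holds (X : nat -> int) (p : nat) (s : seq int) : Prop :=
  forall c, (c < size s)%N -> X (p + 3 * c)%N = nth 0 s c.

(** Three arrays of unknown length share the memory with stride 3; a write to another residue class,
    or below the array, leaves it intact. *)
Lemma holds_assign X p s a v :
  (a < p)%N || (a %% 3 != p %% 3)%N -> holds X p s -> holds (assign X a v) p s.
Proof.
move=> ne_a hX c lt_c; rewrite /assign ifN ?hX //.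
by apply: contraTneq ne_a => <-; lia.
Qed.

Lemma holds_behead X p v s : holds X p (v :: s) -> holds X (p + 3) s.
Proof. by move=> hX c lt_c; rewrite -addnA -mulnS hX. Qed.

Lemma holds_rcons X p s v :
  holds X p s -> holds (assign X (p + 3 * size s) v) p (rcons s v).
Proof.
move=> hX c; rewrite size_rcons ltnS leq_eqVlt nth_rcons /assign.
case/orP=> [/eqP->|lt_c]; first by rewrite eqxx ltnn eqxx.
by rewrite lt_c ifN ?hX //; lia.
Qed.

(* Registers: 0 holds n, 1 and 2 the constants 1 and 3, 11 the constant 0, 3 a
   counter, and 4, 5, 6, 9, 10 pointers. Cell 12 + 3t receives x_t; the cells
   13 + 3c and 14 + 3c receive the c-th index with x_i > x'_i, resp. x_i < x'_i.
   Jump targets are absolute, so each block starts with its address. *)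
Definition reconf_program : program :=
  [:: ReadIn 0; SetConst 1 1; SetConst 2 3;
      (* 3: skip pi *)
      AddReg 3 0 11; JumpPos 7 1; ReadIn 7; SubReg 3 3 1; JumpPos 5 3;
      (* 8: store x *)
      AddReg 3 0 11; SetConst 4 12; JumpPos 15 1;
      ReadIn 7; StoreAt 4 7; AddReg 4 4 2; SubReg 3 3 1; JumpPos 11 3;
      (* 16: compare x with x' *)
      SetConst 4 12; SetConst 5 13; SetConst 6 14; JumpPos 28 1;
      AddReg 3 3 1; ReadIn 7; LoadFrom 8 4; AddReg 4 4 2; SubReg 8 8 7;
      JumpPos 31 8; SubReg 8 11 8; JumpPos 34 8;
      SubReg 8 0 3; JumpPos 20 8; JumpPos 37 1;
      StoreAt 5 3; AddReg 5 5 2; JumpPos 28 1;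
      StoreAt 6 3; AddReg 6 6 2; JumpPos 28 1;
      (* 37: output the pairs *)
      SetConst 9 13; SetConst 10 14; JumpPos 46 1;
      LoadFrom 8 9; WriteOut 8; LoadFrom 8 10; WriteOut 8;
      AddReg 9 9 2; AddReg 10 10 2;
      SubReg 8 5 9; JumpPos 40 8].

Lemma assignE X a v b : assign X a v b = if b == a then v else X b.
Proof. by []. Qed.

Local Ltac exec :=
  first [ eapply halts_SetConst; [reflexivity|]
        | eapply halts_AddReg; [reflexivity|]
        | eapply halts_SubReg; [reflexivity|]
        | eapply halts_JumpPos; [reflexivity|]
        | eapply halts_ReadIn; [reflexivity|]
        | eapply halts_WriteOut; [reflexivity|] ]; rewrite ?assignE /=.

Local Notation runs := (halts reconf_program).

Definition interleave (D I : seq int) : seq int :=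
  flatten [seq [:: u.1; u.2] | u : int * int <- zip D I].

(** Each pair costs 8 instructions and the failing test 2. Register 5, the end of the first list,
    also ends the second, which is equally long. *)
Lemma runs_output D I (X : nat -> int) (p q : nat) inp out :
  size D = size I -> X 2%N = 3 -> X 5%N = (p + 3 * size D)%N -> X 9%N = p ->
  X 10%N = q -> (12 <= p)%N -> (12 <= q)%N -> holds X p D -> holds X q I ->
  runs (8 * size D + 2) (Config 46 X inp out) (out ++ interleave D I).
Proof.
elim: D I X p q out => [|d D IHD] [|e I] //= X p q out.
  move=> _ X2 X5 X9 _ _ _ _ _; rewrite cats0 muln0 add0n.
  do 2!exec; rewrite /assign /= X5 X9 addn0 subrr /=; exact: halts_end.
case=> eqsz X2 X5 X9 X10 ge_p ge_q hD hI.
have Xp : X p = d by have := hD 0%N isT; rewrite muln0 addn0.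
have Xq : X q = e by have := hI 0%N isT; rewrite muln0 addn0.
have neq r a : (12 <= r)%N -> (a < 12)%N -> (r == a) = false by lia.
rewrite mulnS !addSn.
exec; exec; rewrite X5 X9.
have -> : 0 < (p + 3 * (size D).+1)%N%:Z - p%:Z by lia.
eapply (@halts_LoadFrom _ _ _ _ _ _ _ _ _ p); [reflexivity|by []|].
rewrite !assignE neq //= Xp.
exec.
eapply (@halts_LoadFrom _ _ _ _ _ _ _ _ _ q); [reflexivity|by []|].
rewrite !assignE !neq //= Xq.
do 3!exec; rewrite X2 X9 X10.
rewrite -[out ++ _]/(out ++ [:: d, e & interleave D I]) -!cat_rcons.
apply: (IHD I _ (p + 3)%N (q + 3)%N) => //=.
- by rewrite !assignE /= X5; lia.
- lia.
- lia.
- by do !(apply: holds_assign; first lia); apply: holds_behead hD.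
- by do !(apply: holds_assign; first lia); apply: holds_behead hI.
Qed.

(** Positions are counted from 1 after [t] earlier entries, as on the output tape. *)
Fixpoint descents (t : nat) (u v : seq int) : seq int :=
  if u is a :: u' then
    if v is b :: v' then
      (if b < a then [:: t.+1%:Z] else [::]) ++ descents t.+1 u' v'
    else [::]
  else [::].

Definition constants (X : nat -> int) : Prop :=
  [/\ X 1%N = 1, X 2%N = 3 & X 11%N = 0].

Lemma constants_assign X a v :
  a \notin [:: 1; 2; 11]%N -> constants X -> constants (assign X a v).
Proof.
by rewrite !inE !negb_or => /and3P[n1 n2 n11] [X1 X2 X11];
  rewrite /constants !assignE ![_ == a]eq_sym !ifN.
Qed.

Local Ltac keep_holds := do ?(apply: holds_assign; first lia).

Local Ltac invariant :=
  first [ lia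
        | by do !(apply: constants_assign; first by rewrite ?inE; lia)
        | by rewrite ?assignE /= ?size_rcons; lia
        | by keep_holds; try (apply: holds_rcons; keep_holds) ].

(** The invariant after [t] comparisons, with [D] and [I] found so far; only the completed lists
    need equal lengths. A rise takes the longest path, 13 instructions. *)
Lemma runs_compare u v D I (X : nat -> int) (t : nat) out :
  size u = size v -> constants X -> X 0%N = (t + size u)%N -> X 3%N = t ->
  X 4%N = (12 + 3 * t)%N -> X 5%N = (13 + 3 * size D)%N ->
  X 6%N = (14 + 3 * size I)%N ->
  holds X (12 + 3 * t) u -> holds X 13 D -> holds X 14 I ->
  let D' := D ++ descents t u v in let I' := I ++ descents t v u in
  size D' = size I' ->
  runs (13 * size u + (8 * size D' + 8)) (Config 28 X v out)
    (out ++ interleave D' I').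
Proof.
elim: u v D I X t out => [|a u IHu] [|b v] D I X t out //=.
  move=> _ [X1 X2 X11] X0 X3 X4 X5 X6 _ hD hI; rewrite !cats0 => eqsz.
  rewrite muln0 add0n addn0 in X0 *; rewrite -[8%N]/(6 + 2)%N addnCA !addSn.
  exec; rewrite X0 X3 subrr; do 2!exec; rewrite X1 /=.
  do 3!exec; rewrite X1 /=.
  apply: (runs_output (p := 13) (q := 14)) => //=.
case=> eqsz cX X0 X3 X4 X5 X6 hu hD hI eqsz'.
have [X1 X2 X11] := cX.
have Xa : X (12 + 3 * t)%N = a by have := hu 0%N isT; rewrite muln0 addn0.
rewrite mulnS -addnA addSn.
exec; rewrite X0 X3; rewrite addSn; exec.
have -> : 0 < (t + (size u).+1)%N%:Z - t%:Z by lia.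
exec; rewrite X1 X3; exec.
have neq r c : (12 <= r)%N -> (c < 12)%N -> (r == c) = false by lia.
have tS : t%:Z + 1 = t.+1 by lia.
eapply (@halts_LoadFrom _ _ _ _ _ _ _ _ _ (12 + 3 * t)); [reflexivity| |].
  by rewrite !assignE.
rewrite !assignE !neq // Xa tS.
do 3!exec; rewrite X2 X4 subr_gt0; move: eqsz'.
have hu' : holds X (12 + 3 * t.+1) u.
  by rewrite mulnSr addnA; apply: holds_behead hu.
case: (ltrgtP a b) => [lt_ab|lt_ba|eq_ab] eqsz'.
- do 2!exec; rewrite X11 sub0r opprB subr_gt0 lt_ab.
  eapply (@halts_StoreAt _ _ _ _ _ _ _ _ _ (14 + 3 * size I)); [reflexivity| |].
    by rewrite !assignE.
  do 2!exec; rewrite X1 X2 X6 ?neq //=.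
  rewrite /= -!cat_rcons in eqsz' *.
  eapply halts_leq; last apply: (IHu v D (rcons I t.+1) _ t.+1) => //;
    try invariant.
- eapply (@halts_StoreAt _ _ _ _ _ _ _ _ _ (13 + 3 * size D)); [reflexivity| |].
    by rewrite !assignE.
  do 2!exec; rewrite X1 X2 X5 ?neq //=.
  rewrite /= -!cat_rcons in eqsz' *.
  eapply halts_leq; last apply: (IHu v (rcons D t.+1) I _ t.+1) => //;
    try invariant.
- do 2!exec; rewrite X11 eq_ab subrr oppr0 ltxx.
  eapply halts_leq; last apply: (IHu v D I _ t.+1) => //;
    try invariant.
Qed.

(** Here [s] is already stored and [u] still on the tape; each entry costs 5 instructions. *)
Lemma runs_store u s v (X : nat -> int) out :
  size (s ++ u) = size v -> constants X -> X 0%N = size v ->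
  X 3%N = size u -> X 4%N = (12 + 3 * size s)%N -> holds X 12 s ->
  size (descents 0 (s ++ u) v) = size (descents 0 v (s ++ u)) ->
  runs (5 * size u + (13 * size v + (8 * size (descents 0 (s ++ u) v) + 13)))
    (Config 15 X (u ++ v) out)
    (out ++ interleave (descents 0 (s ++ u) v) (descents 0 v (s ++ u))).
Proof.
elim: u s X => [|a u IHu] s X eqsz cX X0 X3 X4 hs eqsz'; have [X1 X2 X11] := cX.
  rewrite cats0 in eqsz eqsz' *; rewrite muln0 add0n -eqsz.
  rewrite -[13%N in X in runs X]/(5 + 8)%N [(_ + (5 + 8))%N]addnCA.
  rewrite [(_ + (5 + _))%N]addnCA !addSn.
  exec; rewrite X3 ltxx; do 4!exec; rewrite X1 /=.
  apply: (@runs_compare s v [::] [::] _ 0%N) => //; try invariant.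
rewrite /= in X3; rewrite mulnS -addnA !addSn.
exec; rewrite X3; exec.
eapply (@halts_StoreAt _ _ _ _ _ _ _ _ _ (12 + 3 * size s)); [reflexivity| |].
  by rewrite !assignE.
do 2!exec; rewrite -cat_rcons in eqsz eqsz' *.
apply: IHu => //; try invariant.
Qed.

Lemma runs_skip r u v (X : nat -> int) out :
  size u = size v -> constants X -> X 0%N = size v -> X 3%N = size r ->
  size (descents 0 u v) = size (descents 0 v u) ->
  runs (3 * size r + (18 * size v + (8 * size (descents 0 u v) + 17)))
    (Config 7 X (r ++ u ++ v) out)
    (out ++ interleave (descents 0 u v) (descents 0 v u)).
Proof.
elim: r X => [|a r IHr] X eqsz cX X0 X3 eqsz'; have [X1 X2 X11] := cX.
  rewrite muln0 add0n -[17%N]/(4 + 13)%N [(_ + (4 + 13))%N]addnCA.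
  rewrite [(_ + (4 + _))%N]addnCA !addSn.
  exec; rewrite X3 ltxx; do 3!exec; rewrite X0 X1 X11 /=.
  eapply halts_leq; last apply: (@runs_store u [::] v) => //; try invariant.
rewrite /= in X3; rewrite mulnS -addnA !addSn.
exec; rewrite X3; do 2!exec.
apply: IHr => //; try invariant.
Qed.

Lemma runs_reconf (r u v : seq int) :
  size u = size v -> size r = size v ->
  size (descents 0 u v) = size (descents 0 v u) ->
  runs (21 * size v + (8 * size (descents 0 u v) + 22))
    (Config 0 (fun=> 0) ((size v)%:Z :: r ++ u ++ v) [::])
    (interleave (descents 0 u v) (descents 0 v u)).
Proof.
move=> eqsz eqszr eqsz'.
rewrite -[22%N]/(5 + 17)%N [(_ + (5 + 17))%N]addnCA.
rewrite [(_ + (5 + _))%N]addnCA !addSn; do 5!exec.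
eapply halts_leq; last apply: (@runs_skip r u v _ [::]) => //; try invariant.
Qed.

(** * From the tapes back to vectors, and the conclusion *)

Lemma descents_map n (f g : 'I_n -> int) (s : seq 'I_n) t :
  [seq val a | a <- s] = iota t (size s) ->
  descents t [seq f a | a <- s] [seq g a | a <- s] =
  [seq (val a).+1%:Z | a <- s & g a < f a].
Proof.
elim: s t => //= a s IHs t [<- /IHs->].
by case: ifP.
Qed.

Lemma descents_enum n (x y : {ffun 'I_n -> int}) :
  descents 0 [seq x a | a <- enum 'I_n] [seq y a | a <- enum 'I_n] =
  [seq (val a).+1%:Z | a <- drops x y].
Proof. by apply: descents_map; rewrite val_enum_ord size_enum_ord. Qed.

Lemma encode_contractions_zip n (D I : seq 'I_n) :
  encode_contractions (zip D I) =
  interleave [seq (val a).+1%:Z | a <- D] [seq (val a).+1%:Z | a <- I].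
Proof.
rewrite /encode_contractions /interleave.
by elim: D I => [|d D IHD] [|e I] //=; rewrite IHD.
Qed.

Theorem theorem5 :
  (forall (n : nat) (pi : 'S_n) (x x' : {ffun 'I_n -> int}),
      (0 < n)%N -> optimal_DV pi x -> optimal_DV pi x' ->
      exists2 m : nat, is_opt_DV pi x x' m & m%:Q = (Delta x x')%:Q / 2) /\
  (exists (P : program) (C : nat),
    forall (n : nat) (pi : 'S_n) (x x' : {ffun 'I_n -> int}) (m : nat),
      (0 < n)%N -> optimal_DV pi x -> optimal_DV pi x' ->
      is_opt_DV pi x x' m ->
      exists s : seq ('I_n * 'I_n),
        [/\ reconfigures pi x s x', size s = m
          & outputs_within P (encode_input pi x x') (C * (n + m))
              (encode_contractions s)]).
Proof.
split=> [n pi x x' _ optx optx'|].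
  exists (size (drops x x')); first exact: is_opt_DV_drops optx optx'.
  rewrite Delta_drops -(size_dropsC optx optx') addnn -muln2 PoszM intrM.
  by rewrite mulfK.
(* The run takes at most [21 n + 8 m + 22] steps, and [22 <= 22 n] since [n] is positive. *)
exists reconf_program, 43%N => n pi x x' m n_gt0 optx optx' optm.
have eqsz := size_dropsC optx optx'.
have -> := is_opt_DV_inj optm (is_opt_DV_drops optx optx').
exists (zip (drops x x') (drops x' x)); split.
- exact: reconfigures_drops.
- by rewrite size1_zip // eqsz.
rewrite encode_contractions_zip -!descents_enum.
have size_enum (f : 'I_n -> int) : size [seq f i | i <- enum 'I_n] = n.
  by rewrite size_map size_enum_ord.
have := @runs_reconf [seq (pi j).+1%:Z | j <- enum 'I_n]
  [seq x i | i <- enum 'I_n] [seq x' i | i <- enum 'I_n].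
rewrite !size_enum !descents_enum !(size_map _ (drops _ _)).
move=> /(_ erefl erefl eqsz) hlt.
by apply/halts_outputs_within/halts_leq/hlt; lia.
Qed.
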